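(* Let $X$ be a discrete topological space and let $\mathcal{R}$ be the subring of $\mathcal{P}(X)$ consisting of all subsets of $X$ which are either finite or cofinite. Then the totally disconnected compactifications of $X$ are, up to isomorphism, precisely the spaces of the form $\operatorname{Spec}(\mathcal{R}')$ where $\mathcal{R}'$ is a ring with ring extensions $\mathcal{R}\subseteq\mathcal{R}'\subseteq\mathcal{P}(X)$. That is: for every such ring $\mathcal{R}'$, the space $\operatorname{Spec}(\mathcal{R}')$ together with the map $X\to\operatorname{Spec}(\mathcal{R}')$, $x\mapsto\mathfrak{m}_x\cap\mathcal{R}'$, is a totally disconnected compactification of $X$; and every totally disconnected compactification of $X$ is isomorphic to one of this form.
   Context: $\mathcal{P}(X)$ denotes the power set ring of $X$: the set of all subsets of $X$ with addition $A+B=(A\cup B)\setminus(A\cap B)$ and multiplication $A\cdot B=A\cap B$. A subset is cofinite if its complement in $X$ is finite. For $x\in X$, $\mathfrak{m}_x=\mathcal{P}(X\setminus\{x\})$, a maximal ideal of $\mathcal{P}(X)$. $\operatorname{Spec}$ carries the Zariski topology. A compact space means a quasi-compact Hausdorff space. A compactification of a topological space $X$ is a compact space $\widetilde X$ together with an open embedding (a continuous injective open map) $\eta:X\to\widetilde X$ such that $\eta(X)$ is dense in $\widetilde X$; it is totally disconnected if $\widetilde X$ is a totally disconnected space. Two compactifications $(\widetilde X,\eta)$ and $(\widetilde X',\eta')$ are isomorphic if there is a homeomorphism $h:\widetilde X\to\widetilde X'$ with $h\circ\eta=\eta'$. *)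

(* Defs.v *)
From HB Require Import structures.
From mathcomp Require Import all_boot all_order all_algebra.
From mathcomp Require Import all_classical all_reals all_analysis.

Set Implicit Arguments.
Unset Strict Implicit.
Unset Printing Implicit Defensive.

Import GRing.Theory.

Local Open Scope classical_set_scope.
Local Open Scope ring_scope.

(* Rings are comPzRingType, so that the zero ring (the power set ring of the
   empty type) is allowed.  For the same reason ring_quotient's prime_idealr,
   which requires a nzRingType, is not used. *)

Record prime_ideal (A : comPzRingType) (p : set A) : Prop := PrimeIdeal {
  prime_ideal0 : p 0;
  prime_idealD : forall a b, p a -> p b -> p (a + b);
  prime_idealMl : forall a b, p b -> p (a * b);
  prime_ideal1 : ~ p 1;
  prime_idealM : forall a b, p (a * b) -> p a \/ p b }.

Record spec (A : comPzRingType) := Spec {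
  spec_ideal : set A;
  specP : prime_ideal spec_ideal }.

HB.instance Definition _ (A : comPzRingType) := gen_eqMixin (spec A).
HB.instance Definition _ (A : comPzRingType) := gen_choiceMixin (spec A).

Section Zariski.
Variable A : comPzRingType.

Definition zero_locus (E : set A) : set (spec A) := [set p : spec A | E `<=` spec_ideal p].

Definition zariski_open : set_system (spec A) :=
  [set U | exists E : set A, U = ~` zero_locus E].

Fact zariski_openT : zariski_open setT.
Proof.
exists setT; apply/seteqP; split => // p _ /= Tp.
by apply: (prime_ideal1 (specP p)); exact: Tp.
Qed.

Fact zariski_openI : setI_closed zariski_open.
Proof.
move=> _ _ [E ->] [F ->].
exists [set c | exists a b, [/\ E a, F b & c = a * b]].
rewrite -setCU; congr (~` _); apply/seteqP; split => p /=.
  move=> EFp c [a [b [Ea Fb ->]]]; case: EFp => [Ep|Fp].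
    by rewrite mulrC; apply: (prime_idealMl (specP p)); exact: Ep.
  by apply: (prime_idealMl (specP p)); exact: Fp.
move=> EFp; apply: contrapT => /not_orP[/existsNP[a /not_implyP[Ea npa]]].
move=> /existsNP[b /not_implyP[Fb npb]].
by case: (prime_idealM (specP p) (EFp (a * b) (ex_intro _ a (ex_intro _ b
  (And3 Ea Fb erefl))))).
Qed.

Fact zariski_open_bigU (I : Type) (f : I -> set (spec A)) :
  (forall i, zariski_open (f i)) -> zariski_open (\bigcup_i f i).
Proof.
move=> /choice[E fE]; exists (\bigcup_i E i).
rewrite (eq_bigcupr (fun i _ => fE i)) -setC_bigcap; congr (~` _).
apply/seteqP; split => [p Ep a [i _ Ea]|p Ep i _ a Ea]; first exact: (Ep i).
by apply: Ep; exists i.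
Qed.

HB.instance Definition _ := isOpenTopological.Build (spec A)
  zariski_openT zariski_openI zariski_open_bigU.

End Zariski.

Section SubringType.
Variables (A : comPzRingType) (S : subringClosed A).

Record subring_sort := Subring { subring_val : A; _ : subring_val \in S }.

HB.instance Definition _ := [isSub for subring_val].
HB.instance Definition _ := [Choice of subring_sort by <:].
HB.instance Definition _ :=
  GRing.SubChoice_isSubComPzRing.Build A _ subring_sort (subringClosedP S).

End SubringType.

Definition power_ring (X : Type) : Type := set X.

Section PowerRing.
Variable X : Type.

HB.instance Definition _ := gen_eqMixin (power_ring X).
HB.instance Definition _ := gen_choiceMixin (power_ring X).

(* setY is the symmetric difference. *)
Let addA : associative (@setY X). Proof. exact: setYA. Qed.
Let addC : commutative (@setY X). Proof. exact: setYC. Qed.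
Let add0 : left_id set0 (@setY X). Proof. exact: set0Y. Qed.
Let addN : left_inverse set0 id (@setY X). Proof. exact: setYK. Qed.
HB.instance Definition _ :=
  GRing.isZmodule.Build (power_ring X) addA addC add0 addN.

Let mulA : associative (@setI X). Proof. exact: setIA. Qed.
Let mulC : commutative (@setI X). Proof. exact: setIC. Qed.
Let mul1 : left_id setT (@setI X). Proof. exact: setTI. Qed.
Let mulD : left_distributive (@setI X) (@setY X). Proof. exact: setIYl. Qed.
HB.instance Definition _ :=
  GRing.Zmodule_isComPzRing.Build (power_ring X) mulA mulC mul1 mulD.

Definition fin_cofin : {pred power_ring X} :=
  fun B => `[< finite_set B \/ finite_set (~` B) >].

Fact fin_cofin_subring_closed : subring_closed fin_cofin.
Proof.
have setYCC (B C : set X) : B `+` C = ~` B `+` ~` C.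
  by apply/seteqP; split => x /=; rewrite /setY /setD /setU /=;
    case: (pselect (B x)); case: (pselect (C x)); tauto.
have setYNC (B C : set X) : ~` (B `+` C) = ~` B `+` C.
  by apply/seteqP; split => x /=; rewrite /setY /setD /setU /=;
    case: (pselect (B x)); case: (pselect (C x)); tauto.
have finY (B C : set X) : finite_set B -> finite_set C -> finite_set (B `+` C).
  by move=> fB fC; rewrite /setY finite_setU; split; exact: finite_setD.
split.
- by apply/asboolP; right; rewrite setCT.
- move=> B C /asboolP fB /asboolP fC; apply/asboolP.
  change (finite_set (B `+` C) \/ finite_set (~` (B `+` C))).
  case: fB fC => fB [fC|fC].
  + by left; exact: finY.
  + by right; rewrite setYC setYNC; exact: finY.
  + by right; rewrite setYNC; exact: finY.
  + by left; rewrite setYCC; exact: finY.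
- move=> B C /asboolP fB /asboolP fC; apply/asboolP.
  change (finite_set (B `&` C) \/ finite_set (~` (B `&` C))).
  case: fB fC => [fB _|fB [fC|fC]].
  + by left; exact: finite_setIl.
  + by left; exact: finite_setIr.
  + by right; rewrite setCI finite_setU.
Qed.

HB.instance Definition _ :=
  GRing.isSubringClosed.Build (power_ring X) fin_cofin fin_cofin_subring_closed.

Definition point_ideal (x : X) : set (power_ring X) :=
  [set B : set X | B `<=` ~` [set x]].

Variable S : subringClosed (power_ring X).

Fact point_ideal_prime (x : X) :
  prime_ideal [set B : subring_sort S | point_ideal x (val B)].
Proof.
have pE (B : set X) : point_ideal x B <-> ~ B x.
  by split => [Bx /Bx /= /(_ erefl)|nBx y By /= yx] //; rewrite yx in By.
split => /=.
- by apply/pE; case.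
- by move=> B C /pE nB /pE nC; apply/pE => -[[]|[]].
- by move=> B C /pE nC; apply/pE => -[].
- by move=> /pE; apply.
- move=> B C /pE nBC; case: (pselect ((val B : set X) x)) => Bx; last first.
    by left; apply/pE.
  by right; apply/pE => Cx; apply: nBC; split.
Qed.

Definition spec_point (x : X) : spec (subring_sort S) :=
  Spec (point_ideal_prime x).

End PowerRing.
Arguments fin_cofin : clear implicits.

Record compactification (X Y : topologicalType) (eta : X -> Y) : Prop :=
  Compactification {
    compactification_compact : compact [set: Y];
    compactification_hausdorff : hausdorff_space Y;
    compactification_continuous : continuous eta;
    compactification_injective : injective eta;
    compactification_open : forall U : set X, open U -> open (eta @` U);
    compactification_dense : dense (range eta) }.

Definition td_compactification (X Y : topologicalType) (eta : X -> Y) : Prop :=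
  compactification eta /\ totally_disconnected [set: Y].

Definition homeomorphism (Y Z : topologicalType) (h : Y -> Z) : Prop :=
  continuous h /\ exists g : Z -> Y, [/\ continuous g, cancel h g & cancel g h].

Definition compactification_iso (X Y Z : topologicalType)
    (eta : X -> Y) (theta : X -> Z) : Prop :=
  exists h : Y -> Z, homeomorphism h /\ h \o eta = theta.

(* Main.v *)
Require Import Defs.
From HB Require Import structures.
From mathcomp Require Import all_boot all_order all_algebra.
From mathcomp Require Import all_classical all_reals all_analysis.

Set Implicit Arguments.
Unset Strict Implicit.
Unset Printing Implicit Defensive.

Import GRing.Theory.

Local Open Scope classical_set_scope.
Local Open Scope ring_scope.

(** A subring R' of the power set ring is Boolean, and the spectrum of a Boolean
ring is a compact space with a basis of clopen sets: the locus where an element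
a vanishes is the complement of the locus where 1 - a vanishes.  Compactness
holds for every commutative ring and comes from ultrafilters: if F is an
ultrafilter on the spectrum, the elements whose zero locus is in F form a prime
ideal, and F converges to it ([compact_spec]).  The finite sets in R' make every
point m_x isolated, since m_x is the only prime ideal that misses {x}; the
points m_x are dense because a nonzero element of R' is a nonempty set B, and
any x in B gives a point m_x that misses B.

Conversely, let eta : X -> Y be a totally disconnected compactification.  Take
for R' the traces on X of the clopen subsets of Y, which is Stone duality: by
density a clopen set is determined by its trace, so R' is a copy of the Boolean
algebra of clopen sets of Y.  It contains the finite sets because each of them
has an image that is open (eta is open) and closed (Y is Hausdorff).  A point
y of Y gives the prime ideal of the traces of the clopen sets that avoid y.
This map from Y to the spectrum is continuous and sends eta x to m_x.  It is
injective because clopen sets separate the points of Y: this is the theorem that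
in a compact Hausdorff space the connected component of a point is the
intersection of its clopen neighbourhoods ([quasi_component_connected]).  It is
surjective because its image is compact, hence closed, and contains the dense
set of the m_x; a continuous bijection from a compact space to a Hausdorff space
is a homeomorphism ([compact_hausdorff_homeomorphism]). *)

(** * Clopen sets *)

Lemma clopen_setC (T : topologicalType) (U : set T) :
  clopen U -> clopen (~` U).
Proof. exact: (clopenC set0). Qed.

Lemma clopenY (T : topologicalType) (U V : set T) :
  clopen U -> clopen V -> clopen (U `+` V).
Proof.
move=> cU cV; rewrite /setY !setDE.
by apply: clopenU; apply: clopenI => //; exact: clopen_setC.
Qed.

Lemma zero_dimensional_hausdorff (T : topologicalType) :
  zero_dimensional T -> hausdorff_space T.
Proof.
move=> zT; rewrite open_hausdorff => x y /zT[U [[oU cU] Ux Uy]].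
exists (U, ~` U) => /=; first by rewrite !inE.
by split => //; [rewrite openC|rewrite setICr].
Qed.

(** * The spectrum of a ring, and of a Boolean ring *)

Section Spectrum.
Variable A : comPzRingType.
Implicit Types (p q : spec A) (a : A) (E : set A).

Lemma spec_inj p q : spec_ideal p = spec_ideal q -> p = q.
Proof.
case: p q => [I Ip] [J Jp] /= IJ; rewrite -IJ in Jp *.
by congr Spec; exact: Prop_irrelevance.
Qed.

Lemma closed_zero_locus E : closed (zero_locus E).
Proof. by rewrite -openC; exists E. Qed.

Lemma zero_locus1U a b :
  zero_locus [set a * b] = zero_locus [set a] `|` zero_locus [set b].
Proof.
apply/seteqP; split => p /=; last first.
  move=> [/(_ a erefl) pa|/(_ b erefl) pb] _ ->.
    by rewrite mulrC; exact: (prime_idealMl (specP p)).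
  exact: (prime_idealMl (specP p)).
move=> /(_ _ erefl) pab.
by case: (prime_idealM (specP p) pab) => [pa|pb]; [left|right] => _ ->.
Qed.

(** An ultrafilter F converges to the ideal of the elements whose zero locus
belongs to F; this ideal is prime because the zero locus of a product is the union of
the zero loci and an ultrafilter containing a union contains one of its
members. *)
Lemma compact_spec : compact [set: spec A].
Proof.
rewrite compact_ultra => F FU _.
have FP : ProperFilter F := ultra_proper.
have lim_prime : prime_ideal [set a | F (zero_locus [set a])].
  split => /=.
  - by apply: filterE => p _ ->; exact: prime_ideal0 (specP p).
  - move=> a b Fa Fb; apply: filterS (filterI Fa Fb) => p /=.
    move=> [/(_ _ erefl) pa /(_ _ erefl) pb] _ ->.
    exact: prime_idealD (specP p) _ _ pa pb.
  - by move=> a b; apply: filterS; rewrite zero_locus1U => p; right.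
  - move=> F1; apply: (filter_not_empty F); apply: filterS F1 => p /(_ 1 erefl).
    exact: prime_ideal1 (specP p).
  - move=> a b; rewrite zero_locus1U => Fab.
    have [|Fna] := in_ultra_setVsetC (zero_locus [set a]) FU; first by left.
    by right; apply: filterS (filterI Fab Fna) => p [[]].
exists (Spec lim_prime); split => // U.
rewrite nbhsE => -[V [[E ->] /=]].
move=> /existsNP[a /not_implyP[Ea Fa]] VU.
have [//|Fna] := in_ultra_setVsetC (zero_locus [set a]) FU.
by apply: filterS Fna => p npa; apply: VU => Ep; apply: npa => _ ->; exact: Ep.
Qed.

Hypothesis idem : forall a : A, a * a = a.

(** A prime ideal contains a or 1 - a since it contains their product, which
is 0, and it cannot contain both since their sum is 1. *)
Lemma boolean_zero_locusC a :
  ~` zero_locus [set a] = zero_locus [set 1 - a].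
Proof.
have a0 : a * (1 - a) = 0 by rewrite mulrBr mulr1 idem subrr.
apply/seteqP; split => p /=.
  move=> npa _ ->; have : spec_ideal p (a * (1 - a)).
    by rewrite a0; exact: prime_ideal0 (specP p).
  by case/(prime_idealM (specP p)) => // pa; case: npa => _ ->.
move=> /(_ _ erefl) pa' /(_ _ erefl) pa; apply: (prime_ideal1 (specP p)).
by rewrite -(subrK a 1); exact: prime_idealD (specP p) _ _ pa' pa.
Qed.

Lemma boolean_clopen_zero_locus a : clopen (zero_locus [set a]).
Proof.
split; last exact: closed_zero_locus.
by rewrite -(setCK (zero_locus _)) boolean_zero_locusC; exists [set 1 - a].
Qed.

Lemma boolean_zero_dimensional : zero_dimensional (spec A).
Proof.
move=> p q /eqP pq.
have [a]: exists a, ~ (spec_ideal p a <-> spec_ideal q a).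
  apply: contrapT => /forallNP pq'; apply: pq; apply: spec_inj.
  by apply/seteqP; split => a; have /contrapT[] := pq' a.
have [pa|npa] := pselect (spec_ideal p a) => naq.
  exists (zero_locus [set a]); split; first exact: boolean_clopen_zero_locus.
    by move=> _ ->.
  by move=> /(_ _ erefl) qa; apply: naq; split.
exists (~` zero_locus [set a]); split.
- exact: clopen_setC (boolean_clopen_zero_locus a).
- by move=> /(_ _ erefl).
- by move=> nZq; apply: nZq => _ ->; apply: contrapT => nqa; apply: naq; split.
Qed.

End Spectrum.

(** * Components of compact Hausdorff spaces *)

Section QuasiComponent.
Variable T : topologicalType.
Hypothesis cT : compact [set: T].

(** The quasi-component of x; it contains the connected component of x in every
space, and the two coincide in a compact Hausdorff space. *)
Definition quasi_component (x : T) : set T :=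
  \bigcap_(D in [set D | clopen D /\ D x]) D.

(** If every clopen neighbourhood D of x left W, the sets D minus W would
generate a proper filter; by compactness it has a cluster point, which lies in
every D, hence in the quasi-component, but not in W. *)
Lemma quasi_component_clopen_nbhs (x : T) (W : set T) :
  open W -> quasi_component x `<=` W ->
  exists D, [/\ clopen D, D x & D `<=` W].
Proof.
move=> oW QW; apply: contrapT => noD.
pose F := filter_from [set D | clopen D /\ D x] (fun D => D `\` W).
have FF : ProperFilter F.
  apply: filter_from_proper.
    apply: filter_from_filter; first by exists setT; split => //; exact: clopenT.
    move=> D D' [cD Dx] [cD' D'x]; exists (D `&` D').
      by split; [exact: clopenI|].
    by move=> y [[Dy D'y] Wy].
  move=> D [cD Dx]; apply: contrapT => /forallNP DW; apply: noD.
  exists D; split => // y Dy; apply: contrapT => Wy; exact: (DW y).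
have [y [_ Fy]] : [set: T] `&` cluster F !=set0 by apply: cT; exact: filterT.
have clF C : closed C -> F C -> C y.
  by move=> cC FC; apply: cC => B yB; exact: Fy.
have : (~` W) y.
  apply: clF; first exact: open_closedC.
  by exists setT; [split => //; exact: clopenT|move=> z []].
apply; apply: QW => D [cD Dx]; apply: clF; first by case: cD.
by exists D => // z [].
Qed.

Hypothesis hT : hausdorff_space T.

(** Suppose that the quasi-component Q is the union of disjoint closed sets B and
Q minus B.  Normality gives a neighbourhood C of B whose closure avoids
Q minus B, so Q lies in the open set made of the interior and the exterior of C,
and so does some clopen neighbourhood D of x.  Inside D the interior and the
closure of C agree, so they cut out a clopen set, which must contain Q or be
disjoint from Q.  Hence Q minus B or B is empty. *)
Lemma quasi_component_connected (x : T) : connected (quasi_component x).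
Proof.
set Q := quasi_component x.
move=> B [b Bb] [W oW BW] [K cK BK].
have cQ : closed Q by apply: closed_bigI => D [[]].
have cB : closed B by rewrite BK; exact: closedI.
have BQ : B `<=` Q by rewrite BW => y [].
have cB' : closed (Q `\` B).
  have -> : Q `\` B = Q `&` ~` W.
    apply/seteqP; split => y [Qy]; rewrite BW.
      by move=> nBy; split => // Wy; exact: nBy.
    by move=> nWy; split => // -[].
  by apply: closedI => //; exact: open_closedC.
have [C CB CB'] : filter_from (set_nbhs B) closure (~` (Q `\` B)).
  apply: compact_normal => // y By; apply: open_nbhs_nbhs.
  by split; [exact: closed_openC|case].
have BC : B `<=` C° by move=> y By; exact: CB.
have [D [cD Dx DW]] : exists D, [/\ clopen D, D x & D `<=` C° `|` ~` closure C].
  apply: quasi_component_clopen_nbhs.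
    by apply: openU; [exact: open_interior|exact/closed_openC/closed_closure].
  move=> y Qy; have [By|nBy] := pselect (B y); first by left; exact: BC.
  by right => /CB'; apply.
have cDC : clopen (D `&` C°).
  split; first by apply: openI; [case: cD|exact: open_interior].
  have -> : D `&` C° = D `&` closure C.
    apply/seteqP; split => y [Dy].
      by move=> /interior_subset Cy; split => //; exact: subset_closure.
    by move=> Cy; split => //; case: (DW y Dy).
  by apply: closedI; [case: cD|exact: closed_closure].
have [DCx|nDCx] := pselect ((D `&` C°) x).
  apply/seteqP; split => // y Qy; apply: contrapT => nBy.
  have [_ /interior_subset/subset_closure/CB'] : (D `&` C°) y by exact: Qy.
  by apply.
have : (~` (D `&` C°)) b by apply: (BQ b Bb); split => //; exact: clopen_setC.
by case; split; [apply: (BQ b Bb)|exact: BC].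
Qed.

Lemma totally_disconnected_zero_dimensional :
  totally_disconnected [set: T] -> zero_dimensional T.
Proof.
move=> tdT x y /eqP xy; apply: contrapT => noU; apply: xy.
suff : [set x] y by [].
rewrite -(tdT x I); exists (quasi_component x); last first.
  by move=> D [cD Dx]; apply: contrapT => Dy; apply: noU; exists D.
split => //; last exact: quasi_component_connected.
by move=> D [].
Qed.

End QuasiComponent.

(** Images of closed sets are compact, hence closed.  For the whole space this
makes the dense range everything, and in general it says that the inverse map is
continuous. *)
Lemma compact_hausdorff_homeomorphism (Y Z : topologicalType) (h : Y -> Z) :
  compact [set: Y] -> hausdorff_space Z -> continuous h -> injective h ->
  dense (range h) -> homeomorphism h.
Proof.
move=> cY hZ ch hI hD.
have clh (C : set Y) : closed C -> closed (h @` C).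
  move=> cC; apply: compact_closed => //; apply: continuous_compact.
    exact: continuous_subspaceT.
  exact: subclosed_compact cC cY _.
have h_surj z : exists y, h y = z.
  apply: contrapT => nz.
  have [||w [nhw hw]] := hD (~` range h).
  - by exists z => -[y _ yz]; apply: nz; exists y.
  - exact/closed_openC/clh/closedT.
  - exact: nhw.
have [g gK] := choice h_surj.
have hK : cancel h g by move=> y; apply: hI; rewrite gK.
split => //; exists g; split => //.
apply/continuous_closedP => C cC; suff -> : g @^-1` C = h @` C by exact: clh.
apply/seteqP; split => [z Cz|_ [y Cy <-]]; last by rewrite /preimage /= hK.
by exists (g z).
Qed.

(** * Rings of sets that contain the finite and cofinite sets *)

Section SpectrumOfSubring.
Variables (X : Type) (S : subringClosed (power_ring X)).

Lemma subring_idem (B : subring_sort S) : B * B = B.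
Proof. by apply: val_inj; exact: setIid. Qed.

Lemma spec_pointE (x : X) (B : subring_sort S) :
  spec_ideal (spec_point S x) B <-> ~ (val B : set X) x.
Proof.
split=> [Bx xB|nBx]; first exact: (Bx x xB).
by change (point_ideal x (val B)) => y By yx; apply: nBx; rewrite -yx.
Qed.

Hypothesis RS : {subset fin_cofin X <= S}.

Let singleton_in (x : X) : ([set x] : power_ring X) \in S.
Proof. by apply: RS; apply/asboolP; left. Qed.

Definition subring_singleton (x : X) : subring_sort S :=
  Subring (singleton_in x).

(** If p misses {x}, then a set B of S that contains x has B * {x} = {x}, so
p misses B, and a set B that does not contain x has B * {x} = 0, so p contains
B. *)
Lemma spec_point_isolated (x : X) :
  ~` zero_locus [set subring_singleton x] = [set spec_point S x].
Proof.
apply/seteqP; split => [p npx|_ ->]; last first.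
  by move=> /(_ _ erefl)/spec_pointE; apply.
have pP := specP p.
apply: spec_inj; apply/seteqP; split => B.
  move=> pB; apply/spec_pointE => Bx; apply: npx => _ ->.
  have -> : subring_singleton x = subring_singleton x * B.
    apply: val_inj; apply/seteqP; split => [y /= yx|y []//].
    by split => //; rewrite yx.
  exact: (prime_idealMl pP).
move=> /spec_pointE Bx.
have : spec_ideal p (subring_singleton x * B).
  suff -> : subring_singleton x * B = 0 by exact: prime_ideal0 pP.
  apply: val_inj; apply/seteqP; split => // y [/= yx].
  by rewrite yx => /Bx.
by case/(prime_idealM pP) => // px; case: npx => _ ->.
Qed.

Lemma spec_point_inj : injective (spec_point S).
Proof.
move=> x y xy; apply: contrapT => nxy.
have /spec_pointE : ~ (val (subring_singleton y) : set X) x by [].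
by rewrite xy => /spec_pointE; apply.
Qed.

Lemma spec_point_dense : dense (range (spec_point S)).
Proof.
move=> U [p Up] [E UE]; move: Up; rewrite UE.
move=> /existsNP[B /not_implyP[EB npB]].
have [x Bx] : (val B : set X) !=set0.
  apply/set0P/eqP => B0; apply: npB.
  suff -> : B = 0 by exact: prime_ideal0 (specP p).
  exact: val_inj.
exists (spec_point S x); split; last by exists x.
by move=> /(_ _ EB)/spec_pointE.
Qed.

End SpectrumOfSubring.

Lemma spec_point_td_compactification (X : discreteTopologicalType)
    (S : subringClosed (power_ring X)) :
  {subset fin_cofin X <= S} ->
  td_compactification (spec_point S : X -> spec (subring_sort S)).
Proof.
move=> RS; have zS := boolean_zero_dimensional (@subring_idem _ S).
split; last exact: zero_dimension_totally_disconnected.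
split.
- exact: compact_spec.
- exact: zero_dimensional_hausdorff.
- by apply/continuousP => U _; exact: discrete_open.
- exact: spec_point_inj.
- move=> U _.
  have -> : spec_point S @` U = \bigcup_(x in U) [set spec_point S x].
    by apply/seteqP; split => [_ [x Ux <-]|_ [x Ux ->]]; exists x.
  apply: bigcup_open => x _; rewrite -(spec_point_isolated RS).
  by exists [set subring_singleton RS x].
- exact: spec_point_dense.
Qed.

(** * The ring of clopen traces *)

Section ClopenTraces.
Variables (X : Type) (Y : topologicalType) (eta : X -> Y).

Definition clopen_trace : {pred power_ring X} :=
  fun B => `[< exists2 U : set Y, clopen U & eta @^-1` U = B >].

Fact clopen_trace_subring_closed : subring_closed clopen_trace.
Proof.
split.
- by apply/asboolP; exists setT; [exact: clopenT|].
- move=> B C /asboolP[U cU UB] /asboolP[V cV VC]; apply/asboolP.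
  by exists (U `+` V); [exact: clopenY|rewrite -UB -VC].
- move=> B C /asboolP[U cU UB] /asboolP[V cV VC]; apply/asboolP.
  by exists (U `&` V); [exact: clopenI|rewrite -UB -VC].
Qed.

HB.instance Definition _ :=
  GRing.isSubringClosed.Build (power_ring X) clopen_trace
    clopen_trace_subring_closed.

Local Notation R' := (subring_sort clopen_trace).

Lemma clopen_traceP (B : R') :
  exists2 U : set Y, clopen U & eta @^-1` U = val B.
Proof. exact/asboolP/(valP B). Qed.

Lemma clopen_trace_mem (U : set Y) :
  clopen U -> (eta @^-1` U : power_ring X) \in clopen_trace.
Proof. by move=> cU; apply/asboolP; exists U. Qed.

Hypothesis etaD : dense (range eta).

(** Otherwise the difference of U and V, or of V and U, would be a nonempty open
set that the dense range of eta misses. *)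
Lemma clopen_trace_inj (U V : set Y) :
  clopen U -> clopen V -> eta @^-1` U = eta @^-1` V -> U = V.
Proof.
wlog suff sub : U V /
    clopen U -> clopen V -> eta @^-1` U = eta @^-1` V -> U `<=` V.
  by move=> cU cV UV; apply/seteqP; split; exact: sub.
move=> [oU cU] [oV cV] UV y Uy; apply: contrapT => Vy.
have [||z [[Uz Vz] [x _ xz]]] := etaD (O := U `\` V).
- by exists y.
- by rewrite setDE; apply: openI => //; exact: closed_openC.
- by apply: Vz; rewrite -xz -[V _]/((eta @^-1` V) x) -UV /preimage /= xz.
Qed.

(** For y = eta x this is the ideal of the sets that avoid x, so it extends
x |-> m_x from X to Y.  When eta has dense range the clopen set U is unique, so a
universal quantifier in place of the existential one gives the same ideal. *)
Definition trace_ideal (y : Y) : set R' :=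
  [set B : R' |
    exists U : set Y, [/\ clopen U, eta @^-1` U = val B & ~ U y]].

Lemma trace_idealE (y : Y) (U : set Y) (B : R') :
  clopen U -> eta @^-1` U = val B -> trace_ideal y B <-> ~ U y.
Proof.
move=> cU UB; split=> [[V [cV VB Vy]]|Uy]; last by exists U.
by rewrite (@clopen_trace_inj U V)// UB.
Qed.

(** A product B * C is the trace of the intersection of the clopen sets that B and
C come from; since a trace comes from only one clopen set, y is outside
that intersection when B * C is in the ideal, hence outside one of the two. *)
Lemma trace_ideal_prime (y : Y) : prime_ideal (trace_ideal y).
Proof.
split.
- by exists set0; split => //; exact: clopen0.
- move=> B C [U [cU UB Uy]] [V [cV VC Vy]]; exists (U `+` V); split.
  + exact: clopenY.
  + by rewrite /= -UB -VC.
  + by move=> [[]|[]].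
- move=> B C; have [U cU UB] := clopen_traceP B.
  move=> [V [cV VC Vy]]; exists (U `&` V); split; [exact: clopenI| |by case].
  by rewrite /= -UB -VC.
- by move=> /(@trace_idealE _ setT); apply => //; exact: clopenT.
- move=> B C; have [U cU UB] := clopen_traceP B.
  have [V cV VC] := clopen_traceP C.
  move=> /(@trace_idealE _ (U `&` V)) nUV.
  have {}nUV : ~ (U `&` V) y.
    by apply: nUV; [exact: clopenI|rewrite /= -UB -VC].
  have [Uy|Uy] := pselect (U y); [right|left].
    by exists V; split => // Vy; exact: nUV.
  by exists U.
Qed.

Definition trace_spec (y : Y) : spec R' := Spec (trace_ideal_prime y).

Lemma trace_spec_eta : trace_spec \o eta = spec_point clopen_trace.
Proof.
apply/funext => x; apply: spec_inj; apply/seteqP.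
have EB B : spec_ideal (trace_spec (eta x)) B <-> ~ (val B : set X) x.
  have [U cU UB] := clopen_traceP B.
  by rewrite -UB; exact: trace_idealE.
by split => B; [move/EB => ?; exact/spec_pointE|move/spec_pointE => ?; exact/EB].
Qed.

Lemma trace_spec_continuous : continuous trace_spec.
Proof.
apply/continuousP => _ [E ->].
have -> : trace_spec @^-1` (~` zero_locus E) =
    \bigcup_(U in [set U | clopen U /\
      exists2 B : R', E B & eta @^-1` U = val B]) U.
  apply/seteqP; split => y.
    move=> /existsNP[B /not_implyP[EB nB]]; have [U cU UB] := clopen_traceP B.
    exists U; first by split => //; exists B.
    by apply: contrapT => Uy; apply: nB; exists U.
  by move=> [U [cU [B EB UB]] Uy] /(_ _ EB)/(trace_idealE y cU UB).
by apply: bigcup_open => U [[]].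
Qed.

Lemma trace_spec_inj : zero_dimensional Y -> injective trace_spec.
Proof.
move=> zY y z yz; apply: contrapT => /eqP/zY[U [cU Uy Uz]].
pose B : R' := Subring (clopen_trace_mem cU).
have /(congr1 (fun p : spec R' => spec_ideal p B)) /= BE := yz.
have : trace_ideal y B by rewrite BE; exists U.
by move/(trace_idealE y cU (erefl : _ = val B)).
Qed.

End ClopenTraces.

Lemma fin_cofin_clopen_trace (X : discreteTopologicalType) (Y : topologicalType)
    (eta : X -> Y) :
  compactification eta -> {subset fin_cofin X <= clopen_trace eta}.
Proof.
move=> [_ hY _ etaI etaO _].
have fin B : finite_set B -> clopen (eta @` B).
  move=> fB; split; first exact/etaO/discrete_open.
  apply: (accessible_finite_set_closed.1 (hausdorff_accessible hY)).
  exact: finite_image.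
have traceK B : eta @^-1` (eta @` B) = B.
  by apply/seteqP; split => [x [z Bz /etaI <-]|x Bx] //; exists x.
move=> B /asboolP[fB|fB]; apply/asboolP.
  by exists (eta @` B); [exact: fin|exact: traceK].
exists (~` (eta @` ~` B)); first exact: clopen_setC (fin _ fB).
change (~` (eta @^-1` (eta @` ~` B)) = B :> set X).
by rewrite (traceK (~` B)) setCK.
Qed.

Theorem theorem8p2 (X : discreteTopologicalType) :
  (forall R' : subringClosed (power_ring X),
     {subset fin_cofin X <= R'} ->
     td_compactification (spec_point R' : X -> spec (subring_sort R'))) /\
  (forall (Y : topologicalType) (eta : X -> Y),
     td_compactification eta ->
     exists R' : subringClosed (power_ring X),
       {subset fin_cofin X <= R'} /\
       compactification_iso eta (spec_point R' : X -> spec (subring_sort R'))).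
Proof.
split=> [S RS|Y eta [ceta tdY]]; first exact: spec_point_td_compactification.
have RS := fin_cofin_clopen_trace ceta.
have [cY hY _ _ _ etaD] := ceta.
have [[_ hS _ _ _ pointD] _] := spec_point_td_compactification RS.
exists (clopen_trace eta : subringClosed (power_ring X)); split => //.
exists (trace_spec etaD); split; last exact: trace_spec_eta.
apply: compact_hausdorff_homeomorphism => //.
- exact: trace_spec_continuous.
- exact/trace_spec_inj/totally_disconnected_zero_dimensional.
- (* The range contains every m_x, as the image of eta x. *)
  move=> O O0 oO; have [p [Op [x _ xp]]] := pointD O O0 oO.
  exists p; split => //; exists (eta x) => //.
  by rewrite -xp -(trace_spec_eta etaD).
Qed.
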